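(* Let $d\geq 2$ be an integer and $c\geq 1$ a real number. For every randomized online coloring algorithm $\mathcal{A}$ with lookahead $l$ and every integer $n\geq\max\{12d^2,\ d\cdot 12^{2c}\}$ with $l\leq c\,n/\log(n/d)$, there exists an $n$-vertex chordal graph $G$ with $\chi(G)=d$, presented by an oblivious adversary, such that the expected number of colors used by $\mathcal{A}$ to color $G$ is $\Omega(\frac{1}{c}\cdot d\cdot\log n)$, with an absolute implicit constant.
   Context: Online graph coloring: the vertices $v_1,\dots,v_n$ arrive one at a time in an order chosen by an adversary; when $v_t$ arrives, its edges to previously presented vertices are revealed, and the algorithm must immediately and irrevocably assign it a color different from the colors of its already-presented neighbors. An algorithm has lookahead $l$ if, upon the arrival of $v_t$, it additionally sees $v_{t+1},\dots,v_{t+l}$ together with their adjacencies to vertices in $\{v_1,\dots,v_{t+l}\}$. An oblivious adversary fixes the graph and order in advance, without knowledge of the algorithm's random choices. The cost is the expected number of distinct colors used. A graph is chordal if every induced cycle on four or more vertices has a chord. Logarithms are base 2. *)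

(* Defs.v *)
From HB Require Import structures.
From mathcomp Require Import all_boot all_order all_algebra.
From mathcomp Require Import all_classical all_reals all_analysis.

Set Implicit Arguments.
Unset Strict Implicit.
Unset Printing Implicit Defensive.

Import Order.TTheory GRing.Theory Num.Theory.

Record sgraph (V : finType) := SGraph {
  adj :> rel V;
  adj_sym : symmetric adj;
  adj_irrefl : irreflexive adj }.

Definition proper_coloring (V : finType) (C : eqType) (G : sgraph V)
    (f : V -> C) : Prop :=
  forall x y, G x y -> f x != f y.

Definition colorable (V : finType) (G : sgraph V) (k : nat) : bool :=
  [exists f : {ffun V -> 'I_k}, forall x, forall y, G x y ==> (f x != f y)].

Lemma colorable_card (V : finType) (G : sgraph V) : exists k, colorable G k.
Proof.
exists #|V|; apply/existsP; exists [ffun x => enum_rank x].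
apply/forallP => x; apply/forallP => y; apply/implyP => xy; rewrite !ffunE.
by apply: contraTneq xy => /enum_rank_inj ->; rewrite adj_irrefl.
Qed.

Definition chromatic_number (V : finType) (G : sgraph V) : nat :=
  ex_minn (colorable_card G).

(* [ucycle G s]: s lists, without repetition, the vertices of a cycle of G.
   A chord is an edge joining two vertices that are not consecutive on s. *)
Definition chordal (V : finType) (G : sgraph V) : Prop :=
  forall s : seq V, ucycle G s -> 4 <= size s ->
  exists x y : V, [/\ x \in s, y \in s, G x y,
                      y != next s x & x != next s y].

Section Induced.
Variables (n m : nat) (le_mn : m <= n) (G : sgraph 'I_n).

Definition prefix_adj : rel 'I_m :=
  fun x y => G (widen_ord le_mn x) (widen_ord le_mn y).

Lemma prefix_adj_sym : symmetric prefix_adj.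
Proof. by move=> x y; rewrite /prefix_adj adj_sym. Qed.

Lemma prefix_adj_irrefl : irreflexive prefix_adj.
Proof. by move=> x; rewrite /prefix_adj adj_irrefl. Qed.

Definition prefix_graph : sgraph 'I_m :=
  SGraph prefix_adj_sym prefix_adj_irrefl.
End Induced.

(* A presented graph is a graph on 'I_n whose vertices are numbered, from 0,
   in order of arrival.  When vertex t arrives, vertices 0, ..., t + l are
   visible (all n of them if t + l >= n), with all their mutual edges. *)
Definition view (l n : nat) (G : sgraph 'I_n) (t : nat) :
    sgraph 'I_(minn (t + l).+1 n) :=
  prefix_graph (geq_minr (t + l).+1 n) G.

(* The color of the vertex arriving at time t, given the m visible vertices
   and the graph they induce.  The view at time t determines all the earlier
   ones, hence also the colors that were assigned before. *)
Definition color_rule := forall t m : nat, sgraph 'I_m -> nat.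

Definition online_coloring (l : nat) (A : color_rule) (n : nat)
    (G : sgraph 'I_n) (t : 'I_n) : nat :=
  A t (minn (t + l).+1 n) (view l G t).

(* A random choice, made in T, of a deterministic algorithm. *)
Record randomized_algorithm (l : nat) (disp : measure_display)
    (T : measurableType disp) := RandomizedAlgorithm {
  rule :> T -> color_rule;
  measurable_rule : forall (t m : nat) (H : sgraph 'I_m),
    measurable_fun [set: T] (fun w => rule w t H);
  proper_rule : forall (w : T) (n : nat) (G : sgraph 'I_n),
    proper_coloring G (online_coloring l (rule w) G) }.

Definition colors_used (l : nat) (disp : measure_display)
    (T : measurableType disp) (A : randomized_algorithm l T) (n : nat)
    (G : sgraph 'I_n) (w : T) : nat :=
  size (undup [seq online_coloring l (A w) G t | t <- enum 'I_n]).

Definition log2 (R : realType) (x : R) : R := (ln x / ln 2)%R.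

(* Main.v *)
Require Import Defs.
From HB Require Import structures.
From mathcomp Require Import all_boot all_order all_algebra zify ring lra.
From mathcomp Require Import all_classical all_reals all_analysis.
From mathcomp Require Import measurable_realfun.

(** Arrange cliques of h = d/2 vertices as the nodes of a 4-ary tree with m
    levels, leaves first, one level per round; l isolated vertices separate two
    rounds, so that nothing about a round is visible during the previous one.
    In every round each node not yet attached tosses a fair coin and, on heads,
    is completely joined to its ancestor at the level of that round.  A node is
    thus joined to at most one later node, which makes the graph chordal with
    cliques of size at most 2h <= d.

    Fix the algorithm's coins.  For a node Y and a color a, let F be the number
    of unattached nodes below Y that use a.  On average F doubles from one level
    to the next, whereas a can be used at Y only if all the coins of the
    unattached nodes using a fall on tails, which has probability 2^-F.  Hence
    the sum over a of 8 (1 - (2/3)^(4F)) grows, on average, by at least h per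
    level.  As each summand is at most 8, the mean number of colors is at least
    h m / 8.  Having m of order log(n/d) / c leaves room for the separators, and
    averaging over the tree's coins gives one graph that is bad for the
    algorithm. *)

Set Implicit Arguments.
Unset Strict Implicit.
Unset Printing Implicit Defensive.

Import Order.TTheory GRing.Theory Num.Theory.

(** * Chordal graphs and colorings *)

(** Arrival order is a perfect elimination order: the two cycle neighbors of the earliest vertex on
    a cycle come later, so they are adjacent, and length at least 4 makes this edge a chord. *)
Lemma chordal_of_later_clique (n : nat) (G : sgraph 'I_n) :
  (forall v u1 u2 : 'I_n, v < u1 -> v < u2 -> G v u1 -> G v u2 ->
     u1 != u2 -> G u1 u2) ->
  chordal G.
Proof.
move=> later s /andP[cs us] s4.
have [v0 v0s] : exists v0, v0 \in s.
  by case: s s4 {cs us} => // v0 s _; exists v0; rewrite mem_head.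
pose v := [arg min_(i < v0 | i \in s) (i : nat)]%N.
have [vs vmin] : v \in s /\ forall i : 'I_n, i \in s -> v <= i.
  by rewrite /v; case: arg_minnP.
have [k s' Es] := rot_to vs.
have usr : uniq (v :: s') by rewrite -Es rot_uniq.
have nE : next (v :: s') =1 next s by move=> x; rewrite -Es next_rot.
have : 4 <= size (v :: s') by rewrite -Es size_rot.
case: s' {Es} usr nE => [|u2 [|b [|c r]]] // usr nE _.
move: usr => /= /and4P[]; rewrite !inE !negb_or.
move=> /and4P[vu2 vb vc _] /and3P[u2b u2c _] /andP[bc _] _.
have n1 : next s v = u2 by rewrite -nE /= eqxx.
have n2 : next s u2 = b by rewrite -nE /= eq_sym (negPf vu2) eqxx.
have n3 : next s b = c.
  by rewrite -nE /= eq_sym (negPf vb) eq_sym (negPf u2b) eqxx.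
have nu1 : next s (prev s v) = v by rewrite next_prev.
have u12 : u2 != prev s v.
  by apply: contra_neq vb => E; rewrite -nu1 -E n2.
have u1b : prev s v != b.
  by apply: contra_neq vc => E; rewrite -nu1 E n3.
have u2s : u2 \in s by rewrite -n1 mem_next.
have u1s : prev s v \in s by rewrite mem_prev.
have lt x : x \in s -> G v x -> v < x.
  move=> xs gx; rewrite ltn_neqAle vmin // andbT.
  by apply: contraTneq gx => /val_inj ->; rewrite adj_irrefl.
have g2 : G v u2 by rewrite -n1 next_cycle.
have g1 : G v (prev s v) by rewrite adj_sym prev_cycle.
exists u2, (prev s v); split=> //.
- by apply: (later v) => //; exact: lt.
- by rewrite n2.
- by rewrite nu1 eq_sym.
Qed.

Lemma colorable_bounded (V : finType) (G : sgraph V) (k : nat) (f : V -> nat) :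
  (forall x, f x < k) -> proper_coloring G f -> colorable G k.
Proof.
move=> fk pf; apply/existsP; exists [ffun x => Ordinal (fk x)].
apply/forallP => x; apply/forallP => y; apply/implyP => xy.
by rewrite !ffunE -val_eqE /= pf.
Qed.

Lemma chromatic_number_clique (V : finType) (G : sgraph V) (k : nat)
    (f : 'I_k -> V) :
  colorable G k -> (forall i j, i != j -> G (f i) (f j)) ->
  chromatic_number G = k.
Proof.
move=> Gk fclique; rewrite /chromatic_number; case: ex_minnP => q Gq qmin.
apply/eqP; rewrite eqn_leq qmin //=.
case/existsP: Gq => g /forallP gP.
have ginj : injective (g \o f).
  move=> i j /= gij; apply/eqP; apply: contraT => /fclique fij.
  by have /forallP/(_ (f j)) := gP (f i); rewrite fij gij eqxx.
by have := leq_card _ ginj; rewrite !card_ord.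
Qed.

Lemma upward_forest_bipartite (T : finType) (lev : T -> nat) (par : rel T) :
  (forall x z, par x z -> lev x < lev z) ->
  (forall x z z', par x z -> par x z' -> z = z') ->
  exists f : T -> bool, forall x z, par x z -> f x != f z.
Proof.
move=> lt_par par_uniq; pose b := (\max_x lev x).+1.
have lev_b x : lev x < b by rewrite ltnS leq_bigmax.
(* Colors are fixed from the top level down, each vertex taking the opposite of its unique parent;
   stage [k] settles the levels from [b - k] up. *)
have step k : exists f : T -> bool,
    forall x z, b <= lev x + k -> par x z -> f x != f z.
  elim: k => [|k [f fP]].
    by exists xpredT => x z; rewrite addn0 leqNgt lev_b.
  exists (fun x => if lev x + k.+1 == b then
           if [pick z | par x z] is Some z then ~~ f z else false else f x).
  move=> x z bx xz; have xz_lt := lt_par _ _ xz.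
  rewrite [lev z + _ == _]gtn_eqF; last by lia.
  case: (lev x + k.+1 =P b) => [_|nb]; last by apply: fP => //; lia.
  case: pickP => [z' /(par_uniq _ _ _ xz) <-|/(_ z)]; last by rewrite xz.
  by case: (f z).
have [f fP] := step b; exists f => x z; apply: fP; exact: leq_addl.
Qed.

Lemma view_eq (l n : nat) (G G' : sgraph 'I_n) (t : nat) :
  (forall x y : 'I_n, x <= t + l -> y <= t + l -> G x y = G' x y) ->
  view l G t = view l G' t.
Proof.
move=> GG'; rewrite /view /prefix_graph.
set e1 := prefix_adj_sym _ _; set e2 := prefix_adj_sym _ _.
set e3 := prefix_adj_irrefl _ _; set e4 := prefix_adj_irrefl _ _.
have E : prefix_adj (geq_minr (t + l).+1 n) G = prefix_adj (geq_minr (t + l).+1 n) G'.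
  apply: funext => x; apply: funext => y; rewrite /prefix_adj.
  by apply: GG' => /=; move: (ltn_ord x) (ltn_ord y); lia.
move: e1 e2 e3 e4; rewrite E => e1 e2 e3 e4.
by rewrite (Prop_irrelevance e1 e2) (Prop_irrelevance e3 e4).
Qed.

(** * The random graph *)

Section Construction.
Variables (m h l d n : nat).
Hypothesis (room : m * (h * 4 ^ m + l) + d <= n).

(* The node [(i, y)] has level [i], and its ancestor at level [i + k] is
   [(i + k, y %/ 4 ^ k)]. *)
Definition node : finType := ('I_m * 'I_(4 ^ m))%type.
Definition coins : finType := {ffun 'I_m -> {ffun node -> bool}}.

Lemma pos_offset (v : node * 'I_h) : v.1.2 * h + v.2 < h * 4 ^ m.
Proof.
have ve := ltn_ord v.2; have := leq_mul (ltn_ord v.1.2) (leqnn h).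
by rewrite mulSn (mulnC (4 ^ m)); apply: leq_trans; rewrite addnC ltn_add2r.
Qed.

Lemma block_bound (v : node * 'I_h) :
  v.1.1 * (h * 4 ^ m + l) + (v.1.2 * h + v.2) + l < m * (h * 4 ^ m + l).
Proof.
have := leq_mul (ltn_ord v.1.1) (leqnn (h * 4 ^ m + l)); rewrite mulSn.
by apply: leq_trans; have := pos_offset v; lia.
Qed.

Lemma pos_subproof (v : node * 'I_h) :
  v.1.1 * (h * 4 ^ m + l) + (v.1.2 * h + v.2) < n.
Proof. by move: room (block_bound v); lia. Qed.

(** A round is a block of [h * 4 ^ m + l] positions: its cliques one after another, then [l]
    positions outside the image of [pos], the isolated separators. *)
Definition pos (v : node * 'I_h) : 'I_n := Ordinal (pos_subproof v).

Lemma pos_lt_lag (u v : node * 'I_h) : u.1.1 < v.1.1 -> pos u + l < pos v.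
Proof.
move=> uv; have := leq_mul uv (leqnn (h * 4 ^ m + l)); rewrite mulSn.
by have := pos_offset u; move=> /=; lia.
Qed.

Lemma pos_lt (u v : node * 'I_h) : u.1.1 < v.1.1 -> pos u < pos v.
Proof. by move=> /pos_lt_lag; apply: leq_ltn_trans; exact: leq_addr. Qed.

Lemma pos_le_level (u v : node * 'I_h) : pos u <= pos v + l -> u.1.1 <= v.1.1.
Proof. by rewrite leqNgt [_ <= v.1.1]leqNgt; apply: contra => /pos_lt_lag. Qed.

Lemma pos_out (v : node * 'I_h) : pos v < n - d.
Proof. by move: room (block_bound v) => /=; lia. Qed.

Lemma pos_inj : injective pos.
Proof.
move=> u v E.
have E1 : u.1.1 = v.1.1 :> nat.
  by apply/eqP; rewrite eqn_leq !pos_le_level ?E ?leq_addr.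
move/(congr1 (@nat_of_ord n)): E => /=; rewrite E1 => /addnI E.
case: u v E1 E => [[i y] e] [[i' y'] e'] /= E1 E.
have h0 : 0 < h by apply: leq_ltn_trans (ltn_ord e).
have E3 : y = y' :> nat.
  by have := congr1 (divn^~ h) E; rewrite !divnMDl // !divn_small // !addn0.
move: E; rewrite E3 => /addnI E4.
by rewrite (val_inj E1) (val_inj E3) (val_inj E4).
Qed.

Definition dec (t : 'I_n) : option (node * 'I_h) := [pick v | pos v == t].

Lemma decK (v : node * 'I_h) : dec (pos v) = Some v.
Proof.
by rewrite /dec; case: pickP => [u /eqP/pos_inj -> //|/(_ v)]; rewrite eqxx.
Qed.

Lemma dec_some (t : 'I_n) v : dec t = Some v -> t = pos v.
Proof. by rewrite /dec; case: pickP => // u /eqP <- [->]. Qed.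

Lemma dec_none (t : 'I_n) : n - d <= t -> dec t = None.
Proof.
move=> td; case E: dec => [v|//]; have := pos_out v.
by rewrite -(dec_some E) ltnNge td.
Qed.

Definition subtree (i y : nat) (x : node) : bool :=
  (x.1 <= i) && (x.2 %/ 4 ^ (i - x.1) == y).

(* The coins of the rounds before [i] leave [x] free; round [i] itself is not
   taken into account. *)
Definition unattached (c : coins) (i : nat) (x : node) : bool :=
  [forall k : 'I_m, (x.1 < k < i) ==> ~~ c k x].

Definition parent (c : coins) (x z : node) : bool :=
  [&& x.1 < z.1, subtree z.1 z.2 x, unattached c z.1 x & c z.1 x].

(** Heads in an earlier round contradicts being unattached at a later one, so the levels agree; a
    node has one ancestor per level. *)
Lemma parent_uniq c x z z' : parent c x z -> parent c x z' -> z = z'.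
Proof.
case: z z' => [i y] [i' y'].
move=> /and4P[/= lt /andP[_ /eqP s] /forallP u p].
move=> /and4P[/= lt' /andP[_ /eqP s'] /forallP u' p'].
have E : i = i' :> nat.
  case: (ltngtP i i') => // ii.
    by move/implyP: (u' i); rewrite lt ii p => /(_ isT).
  by move/implyP: (u i'); rewrite lt' ii p' => /(_ isT).
move: s s'; rewrite E => s s'.
by rewrite (val_inj E) (val_inj (etrans (esym s) s')).
Qed.

(* The last [d] vertices form a clique, which forces the chromatic number. *)
Definition gadj (c : coins) : rel 'I_n := fun t u =>
  match dec t, dec u with
  | Some (x, e), Some (z, f) =>
      [|| (x == z) && (e != f), parent c x z | parent c z x]
  | None, None => [&& n - d <= t, n - d <= u & t != u]
  | _, _ => false
  end.

Lemma gadj_sym c : symmetric (gadj c).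
Proof.
move=> t u; rewrite /gadj; case: dec => [[x e]|]; case: dec => [[z f]|] //.
  by rewrite (eq_sym x) (eq_sym e) (orbC (parent c x z)).
by rewrite andbCA (eq_sym t).
Qed.

Lemma gadj_irrefl c : irreflexive (gadj c).
Proof.
move=> t; rewrite /gadj; case: dec => [[x e]|]; last by rewrite eqxx !andbF.
by rewrite !eqxx /= /parent ltnn.
Qed.

Definition gadget (c : coins) : sgraph 'I_n :=
  SGraph (gadj_sym c) (gadj_irrefl c).

Lemma gadget_chordal c : chordal (gadget c).
Proof.
apply: chordal_of_later_clique => v u1 u2 /=; rewrite /gadj.
case Ev: (dec v) => [[x e]|]; case E1: (dec u1) => [[z1 f1]|];
  case E2: (dec u2) => [[z2 f2]|] //; last first.
  by move=> _ _ /and3P[_ -> _] /and3P[_ -> _] ->.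
rewrite (dec_some Ev) (dec_some E1) (dec_some E2) => lt1 lt2.
have up z f : pos (x, e) < pos (z, f) -> parent c z x = false.
  move=> lt; apply/negP => /and4P[zx _ _ _].
  by have := @pos_lt (z, f) (x, e) zx; rewrite ltnNge (ltnW lt).
rewrite (up _ _ lt1) (up _ _ lt2) !orbF (inj_eq pos_inj) xpair_eqE negb_and.
case/orP=> [/andP[/eqP<- _]|p1] /orP[/andP[/eqP<- _]|p2].
- by rewrite eqxx /= => ->.
- by rewrite p2 orbT.
- by rewrite p1 !orbT.
- by rewrite (parent_uniq p1 p2) eqxx /= => ->.
Qed.

(** The parent relation is two-colorable, so two palettes of [h] colors suffice for the tree; the
    final clique needs all [d] colors. *)
Lemma gadget_chromatic c : 2 * h <= d -> 0 < d -> chromatic_number (gadget c) = d.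
Proof.
move=> hd d0; have dn : d <= n by apply: leq_trans room; exact: leq_addl.
have [f fP] : exists f : node -> bool, forall x z, parent c x z -> f x != f z.
  apply: (@upward_forest_bipartite _ (fun x : node => x.1 : nat)).
    by move=> x z /and4P[].
  exact: parent_uniq.
pose col (t : 'I_n) : nat :=
  if dec t is Some (x, e) then e + f x * h else t - (n - d).
have kP (i : 'I_d) : n - d + i < n by move: (ltn_ord i); lia.
apply: (@chromatic_number_clique _ _ _ (fun i => Ordinal (kP i))).
  apply: (@colorable_bounded _ _ _ col) => [t|t u /=].
    rewrite /col; case: dec => [[x e]|]; move: (ltn_ord t); last by lia.
    by move: (ltn_ord e); case: (f x); lia.
  have colneq x z (e e' : 'I_h) : f x != f z -> e + f x * h != e' + f z * h.
    by move: (ltn_ord e) (ltn_ord e'); case: (f x) (f z) => [] [] //=; lia.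
  rewrite /gadj /col; case: dec => [[x e]|]; case: dec => [[z e']|] //.
    case/or3P => [/andP[/eqP<-]|/fP|/fP]; [|exact: colneq|].
      by rewrite eqn_add2r.
    by rewrite eq_sym; exact: colneq.
  by move=> /and3P[tn un]; rewrite -val_eqE /=; lia.
move=> i j ij /=; rewrite /gadj !dec_none /= ?leq_addr //=.
by rewrite -val_eqE /= eqn_add2l.
Qed.

Lemma unattached_local (c c' : coins) i x :
  (forall k : 'I_m, k < i -> c k = c' k) ->
  unattached c i x = unattached c' i x.
Proof.
move=> cc; apply: eq_forallb => k.
by case: ltnP => //= xk; case: ltnP => //= ki; rewrite cc.
Qed.

Lemma parent_local (c c' : coins) i (x z : node) :
  (forall k : 'I_m, k <= i -> c k = c' k) -> z.1 <= i ->
  parent c x z = parent c' x z.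
Proof.
move=> cc zi; rewrite /parent cc // (unattached_local (c' := c')) // => k kz.
by apply: cc; lia.
Qed.

(** The separators end the view before the next level, and edges between visible vertices depend
    only on rounds up to the current one. Hence the algorithm cannot anticipate later coins. *)
Lemma gadget_local (A : color_rule) (c c' : coins) (v : node * 'I_h) :
  (forall k : 'I_m, k <= v.1.1 -> c k = c' k) ->
  online_coloring l A (gadget c) (pos v) =
  online_coloring l A (gadget c') (pos v).
Proof.
move=> cc; rewrite /online_coloring; congr (A _ _ _); apply: view_eq.
move=> t u tv uv /=; rewrite /gadj.
case Et: (dec t) => [[x e]|]; case Eu: (dec u) => [[z f]|] //.
have xv : x.1 <= v.1.1 by apply: (@pos_le_level (x, e)); rewrite -(dec_some Et).
have zv : z.1 <= v.1.1 by apply: (@pos_le_level (z, f)); rewrite -(dec_some Eu).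
by rewrite !(parent_local _ cc).
Qed.

End Construction.

(** * Coin tossing and the potential function *)

Local Open Scope ring_scope.

(** Independence of the coins, with sums for means. Taking [(p, q) = (1, theta)] gives the mean of
    [theta] to the number of tails; [(0, 1)] gives the probability of all tails. *)
Lemma sum_coin_prod (R : realFieldType) (I : finType) (W : {set I}) (p q : R) :
  \sum_(s : {ffun I -> bool}) \prod_(x in W) (if s x then p else q) =
  2 ^+ #|I| * ((p + q) / 2) ^+ #|W|.
Proof.
pose F (x : I) (b : bool) : R := if x \in W then (if b then p else q) else 1.
transitivity (\sum_(s : {ffun I -> bool}) \prod_x F x (s x)).
  by apply: eq_bigr => s _; rewrite big_mkcond.
rewrite -bigA_distr_bigA /=.
under eq_bigr => x _ do rewrite big_bool /=.
have -> : 2 ^+ #|I| = \prod_(x : I) 2 :> R by rewrite prodr_const.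
have -> : ((p + q) / 2) ^+ #|W| = \prod_(x in W) ((p + q) / 2).
  by rewrite prodr_const.
rewrite [\prod_(x in W) _]big_mkcond -big_split /=.
apply: eq_bigr => x _; rewrite /F; case: (x \in W); last by rewrite mulr1.
by field.
Qed.

Lemma prod_coin_card (R : realFieldType) (I : finType) (W : {set I})
    (s : I -> bool) (q : R) :
  \prod_(x in W) (if s x then 1 else q) = q ^+ #|[set x in W | ~~ s x]|.
Proof.
rewrite -prodr_const big_mkcond [RHS]big_mkcond; apply: eq_bigr => x _.
by rewrite inE; case: (x \in W); case: (s x).
Qed.

Section Resample.
Variables (I S : finType) (i : I).

Definition upd (c : {ffun I -> S}) (s : S) : {ffun I -> S} :=
  [ffun j => if j == i then s else c j].

Lemma upd_eq c s : upd c s i = s.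
Proof. by rewrite ffunE eqxx. Qed.

Lemma upd_neq c s j : j != i -> upd c s j = c j.
Proof. by move=> /negPf ji; rewrite ffunE ji. Qed.

(** Redrawing one coordinate preserves the uniform distribution: exchanging the fresh value with the
    old one is an involution on pairs. *)
Lemma sum_upd (R : realFieldType) (f : {ffun I -> S} -> R) :
  \sum_c \sum_s f (upd c s) = #|S|%:R * \sum_c f c.
Proof.
rewrite pair_big /=.
pose g (p : {ffun I -> S} * S) := (upd p.1 p.2, p.1 i).
have gK : involutive g.
  case=> c s; rewrite /g /= upd_eq; congr pair.
  by apply/ffunP => j; rewrite !ffunE; case: eqP => [->|].
transitivity (\sum_(p : {ffun I -> S} * S) f (g p).1) => //.
rewrite -(reindex_inj (inv_inj gK) (F := fun p => f p.1) (P := xpredT)) /=.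
rewrite -(pair_big xpredT xpredT (fun c _ => f c)) /= mulr_sumr.
by apply: eq_bigr => c _; rewrite sumr_const mulr_natl.
Qed.

End Resample.

Section Rates.
Variable R : realFieldType.
Implicit Type F : nat.

(** The fourth power matches the arity of the tree: averaging over four children replaces [theta] by
    its fourth root [2 / 3]. *)
Definition theta : R := (2 / 3) ^+ 4.

Definition gain F : R := 8 * (1 - theta ^+ F).

Lemma gain0 : gain 0 = 0.
Proof. by rewrite /gain expr0 subrr mulr0. Qed.

Lemma theta_pow_bounds F : 0 <= theta ^+ F <= 1.
Proof.
have t0 : 0 <= theta by rewrite /theta; lra.
by rewrite exprn_ge0 // exprn_ile1 // /theta; lra.
Qed.

Lemma gain_le F : gain F <= 8 * (0 < F)%N%:R.
Proof.
case: F => [|F]; first by rewrite gain0 ltnn mulr0.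
by have := theta_pow_bounds F.+1; rewrite /gain /= => ?; lra.
Qed.

Lemma gainS F : gain F.+1 = gain F + 8 * (1 - theta) * theta ^+ F.
Proof. by rewrite /gain exprS; ring. Qed.

(** The second term is the chance that a color held by [F] waiting nodes stays usable. For [F > 0],
    the first falls short of the right side by at least 8 (2/3 - 97/162) (2/3)^(F-1), and 8 (2/3 -
    97/162) = 88/162 exceeds 1/2; this is what the factor 8 is for. *)
Lemma rate_le F :
  8 * ((1 + theta) / 2) ^+ F + (0 < F)%N%:R * (1 / 2) ^+ F <= 8 * (2 / 3) ^+ F.
Proof.
case: F => [|F]; first by rewrite !expr0 /=; lra.
rewrite /= [X in _ + X]mul1r.
pose v : R := (1 + theta) / 2; pose u : R := 2 / 3.
have uvE : v = 97 / 162 by rewrite /v /theta; lra.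
have v0 : 0 <= v by lra.
have u0 : 0 <= u by rewrite /u; lra.
have h1 : v ^+ F.+1 <= v * u ^+ F.
  by rewrite exprS ler_wpM2l // lerXn2r // /u; lra.
have h2 : (1 / 2) ^+ F <= u ^+ F by rewrite lerXn2r // ?nnegrE /u; lra.
have h3 : 0 <= (1 / 2 : R) ^+ F by rewrite exprn_ge0 //; lra.
rewrite -/v -/u [(1 / 2) ^+ F.+1]exprS [u ^+ F.+1]exprS.
move: h1 h2 h3; rewrite uvE; set a := _ ^+ F.+1; set b := u ^+ F; rewrite /u; lra.
Qed.

(* AM-GM on the four numbers [(2/3) ^+ F k]. *)
Lemma gain_mean (F : 'I_4 -> nat) :
  (\sum_k gain (F k)) / 4 <= 8 * (1 - (2 / 3) ^+ (\sum_k F k)%N).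
Proof.
rewrite !big_ord_recl !big_ord0 /= !addr0 !addn0 /gain /theta -!exprM.
rewrite !(mulnC 4) !exprM !exprD !expr1.
set a := _ ^+ F _; set b := _ ^+ F _; set c := _ ^+ F _; set e := _ ^+ F _.
have := sqr_ge0 (a ^+ 2 - b ^+ 2); have := sqr_ge0 (c ^+ 2 - e ^+ 2).
by have := sqr_ge0 (a * b - c * e); lra.
Qed.

End Rates.

(** * Growth of the potential *)

Section Potential.
Variables (m h : nat) (col : coins m -> node m -> 'I_h -> nat).
Hypothesis col_inj : forall c x, injective (col c x).
Hypothesis col_parent : forall c x z e f, parent c x z -> col c x e != col c z f.
Hypothesis col_local : forall (c c' : coins m) (x : node m) e,
  (forall k : 'I_m, (k <= x.1)%N -> c k = c' k) -> col c x e = col c' x e.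

Definition has_color (c : coins m) (x : node m) (a : nat) : bool :=
  [exists e, col c x e == a].

(* [waiting] and [freeset] are the unattached nodes with color [a] in the subtree
   of [(i, y)], just before and just after round [i]. *)
Definition waiting (c : coins m) (i y a : nat) : {set node m} :=
  [set x : node m | [&& (x.1 < i)%N, subtree i y x, unattached c i x & has_color c x a]].

Definition freeset (c : coins m) (i y a : nat) : {set node m} :=
  [set x : node m | [&& subtree i y x, unattached c i.+1 x & has_color c x a]].

Lemma card_waitingS c i y a :
  (#|waiting c i.+1 y a| = \sum_(k < 4) #|freeset c i (4 * y + k) a|)%N.
Proof.
(* [q x] is the index of the ancestor of [x] at level [i]; modulo 4 it tells which child of
   [(i + 1, y)] that is. *)
pose q (x : node m) := (x.2 %/ 4 ^ (i - x.1))%N.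
rewrite -sum1_card (partition_big (fun x => inord (q x %% 4) : 'I_4) xpredT) //=.
apply: eq_bigr => k _; rewrite sum1dep_card; apply: eq_card => x.
rewrite !inE /subtree ltnS; case: leqP => //= xi; rewrite (leqW xi) /=.
rewrite subSn // expnSr divnMA -/(q x) -val_eqE /= inordK ?ltn_mod //.
case: unattached => //=; rewrite ?andbF //=; case: has_color; rewrite ?andbF //= !andbT.
by apply/idP/idP; move: (ltn_ord k); lia.
Qed.

Lemma unattachedS c (i : 'I_m) x :
  unattached c i.+1 x = unattached c i x && ((x.1 < i)%N ==> ~~ c i x).
Proof.
apply/forallP/andP => [u|[/forallP u ui] k].
  split; last by have := u i; rewrite ltnSn andbT.
  apply/forallP => k; have := u k; case: (ltnP k i) => ki; last by rewrite andbF.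
  by rewrite ltnS (ltnW ki).
rewrite ltnS (leq_eqVlt k); case: (eqVneq (k : nat) i) => [/val_inj ->|_] /=.
  by rewrite andbT.
exact: u.
Qed.

Lemma card_free c (i : 'I_m) (y : 'I_(4 ^ m)) a :
  #|freeset c i y a| =
  (#|[set x in waiting c i y a | ~~ c i x]| + has_color c (i, y) a)%N.
Proof.
rewrite (cardsD1 (i, y)) addnC; congr addn.
  apply: eq_card => x; rewrite !inE unattachedS /subtree.
  case: (ltngtP x.1 i) => /= [xi|_|xi]; last 2 first.
  - by rewrite andbF.
  - rewrite xi subnn expn0 divn1; case: eqVneq => //= nx.
    apply/negP => /andP[/eqP/val_inj xy _]; case/eqP: nx.
    by case: x xi xy => x1 x2 /= /val_inj -> ->.
  - have -> : x != (i, y) by apply: contraTneq xi => ->; rewrite ltnn.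
    by case: (_ == _); case: unattached; case: has_color; case: (c i x).
rewrite inE /subtree /= leqnn subnn expn0 divn1 eqxx /= unattachedS ltnn /= andbT.
by have -> : unattached c i (i, y);
  first by apply/forallP => k /=; case: ltngtP.
Qed.

Lemma has_color_waiting c (i : 'I_m) (y : 'I_(4 ^ m)) a x :
  has_color c (i, y) a -> x \in waiting c i y a -> ~~ c i x.
Proof.
move=> /existsP[f /eqP Ef]; rewrite inE => /and4P[xi xy ux /existsP[e /eqP Ee]].
apply/negP => cx; have := @col_parent c x (i, y) e f.
by rewrite Ef Ee eqxx /parent xi xy ux cx => /(_ isT).
Qed.

(** This allows redrawing the coins of round [i] with the waiting set held fixed. *)
Lemma waiting_local (c c' : coins m) i y a :
  (forall k : 'I_m, (k < i)%N -> c k = c' k) ->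
  waiting c i y a = waiting c' i y a.
Proof.
move=> cc; apply/setP => x; rewrite !inE (unattached_local _ cc).
case: ltnP => //= xi; congr [&& _, _ & _]; apply: eq_existsb => e.
by rewrite (col_local (c' := c')) // => k kx; apply: cc; exact: leq_ltn_trans xi.
Qed.

Section Growth.
Variables (R : realFieldType) (M : nat).
Hypothesis colM : forall c x e, (col c x e < M)%N.

Local Notation gain := (@gain R).

Lemma sum_has_color c x : \sum_(a < M) (has_color c x a)%:R = h%:R :> R.
Proof.
rewrite -natr_sum; congr _%:R; rewrite -big_mkcond /= sum1_card.
pose g (e : 'I_h) := Ordinal (colM c x e).
have ginj : injective g by move=> e e' /(congr1 val) /= /col_inj.
rewrite -[RHS]card_ord -(card_codom ginj); apply: eq_card => a.
apply/existsP/codomP => [[e /eqP Ee]|[e ->]]; last by exists e.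
by exists e; exact/val_inj.
Qed.

(** If [(i, y)] uses [a], all waiting coins are tails. The subtracted 1 is then paid by the second
    term on the left or, when nothing was waiting, by the jump 8 (1 - theta) = 520/81 of [gain]. *)
Lemma gain_free_ge c (i : 'I_m) (y : 'I_(4 ^ m)) a :
  8 * (1 - \prod_(x in waiting c i y a) (if c i x then 1 else theta R))
    - (0 < #|waiting c i y a|)%N%:R
      * \prod_(x in waiting c i y a) (if c i x then 0 else 1)
  <= gain #|freeset c i y a| - (has_color c (i, y) a)%:R.
Proof.
rewrite card_free; set W := waiting c i y a; rewrite prod_coin_card.
set F := #|[set x in W | _]|.
case Ha: has_color; last first.
  rewrite addn0 subr0 /gain gerBl mulr_ge0 // prodr_ge0 // => x _.
  by case: (c i x).
have cW x : x \in W -> c i x = false.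
  by move=> xW; apply/negbTE/(has_color_waiting Ha).
have EF : F = #|W|.
  apply: eq_card => x; rewrite [LHS]inE; case xW: (x \in W) => //=.
  by rewrite cW.
rewrite [X in _ - _ * X]big1 => [|x /cW -> //]; rewrite mulr1 addn1 gainS EF.
have th : theta R = 16 / 81 by rewrite /theta; lra.
have := theta_pow_bounds R #|W|.
case: #|W| => [|k]; first by rewrite gain0 expr0 th ltnn mulr0n mulr1n => _; lra.
rewrite /gain ltn0Sn !mulr1n; move: (theta R ^+ k.+1) => t /andP[t0 _].
by rewrite th; lra.
Qed.

Lemma sum_coins_step (i : 'I_m) (y : 'I_(4 ^ m)) :
  #|coins m|%:R * h%:R
    + \sum_(c : coins m) \sum_(a < M) 8 * (1 - (2 / 3) ^+ #|waiting c i y a|)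
  <= \sum_(c : coins m) \sum_(a < M) gain #|freeset c i y a|.
Proof.
pose S : finType := {ffun node m -> bool}.
have S0 : 0 < #|S|%:R :> R.
  by rewrite ltr0n; apply/card_gt0P; exists [ffun=> true].
have SE : #|S|%:R = 2 ^+ #|node m| :> R by rewrite card_ffun card_bool natrX.
have sumS (x : R) : \sum_(s : S) x = #|S|%:R * x.
  by rewrite sumr_const mulr_natl.
(* The coins of round [i] are redrawn on both sides; for fixed [c] each color can then be treated
   alone. The term in [h] counts the colors used at [(i, y)]. *)
rewrite -(ler_pM2l S0) mulrDr -!(sum_upd i).
have -> : #|S|%:R * (#|coins m|%:R * h%:R) =
    \sum_(c : coins m) \sum_(s : S) \sum_(a < M)
      (has_color (upd i c s) (i, y) a)%:R :> R.
  under eq_bigr => c _ do under eq_bigr => s _ do rewrite sum_has_color.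
  by rewrite !sumr_const !mulr_natl mulrnAC.
rewrite -lerBrDl -sumrB; apply: ler_sum => c _; rewrite -sumrB.
have Wupd s a : waiting (upd i c s) i y a = waiting c i y a.
  by apply: waiting_local => k ki; rewrite upd_neq // -val_eqE neq_ltn ki.
under [leRHS]eq_bigr => s _ do rewrite -sumrB.
rewrite exchange_big [leRHS]exchange_big /=; apply: ler_sum => a _.
under eq_bigr => s _ do rewrite Wupd.
set W := waiting c i y a.
rewrite sumS.
apply: (@le_trans _ _ (\sum_(s : S)
    (8 * (1 - \prod_(x in W) (if s x then 1 else theta R))
     - (0 < #|W|)%N%:R * \prod_(x in W) (if s x then 0 else 1)))); last first.
  apply: ler_sum => s _; have := gain_free_ge (upd i c s) i y a.
  by rewrite Wupd upd_eq.
rewrite sumrB -!mulr_sumr sumrB !sum_coin_prod sumS mulr1 -SE add0r.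
set r1 := (_ / 2) ^+ _; set r2 := (1 / 2) ^+ _.
have -> : 8 * (#|S|%:R - #|S|%:R * r1) - (0 < #|W|)%N%:R * (#|S|%:R * r2) =
    #|S|%:R * (8 * (1 - r1) - (0 < #|W|)%N%:R * r2) by ring.
by rewrite ler_pM2l //; have := rate_le R #|W|; rewrite -/r1 -/r2; lra.
Qed.

(** Induction up the tree, each level adding [h] to the mean. The condition on [y] says that the
    subtree of [(i, y)] is complete, and it passes to the four children. *)
Lemma sum_coins_gain i (y : nat) : (i < m)%N -> (y.+1 * 4 ^ i <= 4 ^ m)%N ->
  #|coins m|%:R * h%:R * i.+1%:R
  <= \sum_(c : coins m) \sum_(a < M) gain #|freeset c i y a|.
Proof.
elim: i y => [|i IHi] y im ym.
  have y4 : (y < 4 ^ m)%N by rewrite expn0 muln1 in ym.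
  apply: le_trans (sum_coins_step (Ordinal im) (Ordinal y4)).
  rewrite mulr1 lerDl sumr_ge0 // => c _; rewrite sumr_ge0 // => a _.
  have -> : #|waiting c (Ordinal im) (Ordinal y4) a| = 0%N.
    by apply: eq_card0 => x; rewrite inE.
  by rewrite expr0 subrr mulr0.
have y4 : (y < 4 ^ m)%N.
  by apply: leq_trans ym; rewrite leq_pmulr // expn_gt0.
apply: le_trans (sum_coins_step (Ordinal im) (Ordinal y4)) => /=.
rewrite -natr1 mulrDr mulr1 addrC lerD2l.
apply: (@le_trans _ _ ((\sum_(k < 4) \sum_(c : coins m) \sum_(a < M)
    gain #|freeset c i (4 * y + k) a|) / 4)).
  rewrite ler_pdivlMr //.
  have -> : #|coins m|%:R * h%:R * i.+1%:R * 4 =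
      \sum_(k < 4) #|coins m|%:R * h%:R * i.+1%:R :> R.
    by rewrite sumr_const card_ord mulr_natr.
  apply: ler_sum => k _; apply: IHi; first exact: ltnW.
  apply: leq_trans ym; rewrite expnS mulnA leq_mul2r; apply/orP; right.
  by move: (ltn_ord k); lia.
rewrite exchange_big mulr_suml; apply: ler_sum => c _.
rewrite exchange_big mulr_suml; apply: ler_sum => a _.
by rewrite card_waitingS; exact: gain_mean.
Qed.

End Growth.
End Potential.

(** At the root [(m - 1, 0)], [gain] is at most 8 for each color in use and 0 for the others. *)
Lemma sum_coins_colors (R : realFieldType) (m h l d n : nat)
    (room : (m * (h * 4 ^ m + l) + d <= n)%N) (A : color_rule) :
  (0 < m)%N ->
  (forall G : sgraph 'I_n, proper_coloring G (online_coloring l A G)) ->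
  #|coins m|%:R * (h%:R * m%:R / 8) <=
  \sum_(c : coins m) (size (undup
     [seq online_coloring l A (gadget room c) t | t <- enum 'I_n]))%:R :> R.
Proof.
move=> m0 proper_A.
pose col (c : coins m) (x : node m) (e : 'I_h) :=
  online_coloring l A (gadget room c) (pos room (x, e)).
(* Colors are arbitrary naturals; finitely many outcomes give a common bound, which makes the
   potential a finite sum. *)
pose M := (\max_(p : coins m * (node m * 'I_h)) col p.1 p.2.1 p.2.2).+1.
have colM c x e : (col c x e < M)%N.
  by rewrite ltnS; exact: (leq_bigmax (c, (x, e))).
have col_inj c x : injective (col c x).
  move=> e f; apply: contra_eq => ef; apply: proper_A.
  by rewrite /= /gadj !decK eqxx ef.
have col_parent c x z e f : parent c x z -> col c x e != col c z f.
  by move=> xz; apply: proper_A; rewrite /= /gadj !decK xz orbT.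
have col_local (c c' : coins m) (x : node m) e :
    (forall k : 'I_m, (k <= x.1)%N -> c k = c' k) -> col c x e = col c' x e.
  by move=> cc; exact: gadget_local.
have im : (m.-1 < m)%N by rewrite prednK.
have ym : (1 * 4 ^ m.-1 <= 4 ^ m)%N by rewrite mul1n leq_pexp2l // leq_pred.
have := sum_coins_gain col_inj col_parent col_local R colM im ym.
rewrite prednK // => main.
suff : \sum_(c : coins m) \sum_(a < M) gain R #|freeset col c m.-1 0 a| <=
    8 * \sum_(c : coins m) (size (undup
     [seq online_coloring l A (gadget room c) t | t <- enum 'I_n]))%:R.
  by move: main; lra.
rewrite mulr_sumr; apply: ler_sum => c _; set s := [seq _ | _ <- _].
apply: (@le_trans _ _ (8 * \sum_(a < M) ((a : nat) \in s)%:R)).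
  rewrite mulr_sumr; apply: ler_sum => a _; apply: le_trans (gain_le _ _) _.
  rewrite ler_pM2l // ler_nat; case: posnP => // /card_gt0P[x].
  rewrite inE => /and3P[_ _ /existsP[e /eqP <-]].
  by rewrite /s /col map_f ?mem_enum.
rewrite ler_pM2l // -natr_sum ler_nat -big_mkcond /= sum1_card cardE.
rewrite -(size_map val); apply: uniq_leq_size.
  by rewrite map_inj_uniq ?enum_uniq //; exact: val_inj.
by move=> _ /mapP[a as' ->]; rewrite mem_undup; rewrite mem_enum in as'.
Qed.

(** * Expectations *)

Section Measurability.
Context (disp : measure_display) (T : measurableType disp) (I : Type).
Variable f : I -> T -> nat.
Hypothesis mf : forall i, measurable_fun [set: T] (f i).

Lemma measurable_mem_map (g : T -> nat) (s : seq I) :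
  measurable_fun [set: T] g ->
  measurable_fun [set: T] (fun w => g w \in [seq f i w | i <- s]).
Proof.
move=> mg; elim: s => [|i s IHs] /=; first exact: measurable_cst.
under eq_fun do rewrite in_cons.
by apply: measurable_or => //; exact: measurable_fun_eqn.
Qed.

Lemma measurable_size_undup (s : seq I) :
  measurable_fun [set: T] (fun w => size (undup [seq f i w | i <- s])).
Proof.
elim: s => [|i s IHs] /=; first exact: measurable_cst.
under eq_fun do rewrite (fun_if size) /= -addn1.
apply: measurable_fun_ifT => //; first exact: measurable_mem_map.
by apply: measurable_fun_addn => //; exact: measurable_cst.
Qed.

End Measurability.

(** Averaging as in Yao's principle: if all expectations were below [b], so would be that of the
    average, against the pointwise bound. *)
Lemma exists_expectation_ge (R : realType) (disp : measure_display)
    (T : measurableType disp) (P : probability T R) (I : finType)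
    (X : I -> T -> R) (b : R) :
  (0 < #|I|)%N -> 0 <= b ->
  (forall i w, 0 <= X i w) -> (forall i, measurable_fun [set: T] (X i)) ->
  (forall w, #|I|%:R * b <= \sum_i X i w) ->
  exists i, (b%:E <= 'E_P[X i])%E.
Proof.
move=> I0 b0 X0 mX sumX; apply: contrapT => /forallNP small.
have lt_b i : ('E_P[X i] < b%:E)%E by rewrite ltNge; exact/negP/small.
have E0 i : (0 <= 'E_P[X i])%E.
  by rewrite unlock; apply: integral_ge0 => w _; rewrite lee_fin.
pose r i := fine ('E_P[X i])%E.
have rE i : ('E_P[X i] = (r i)%:E)%E.
  rewrite /r fineK // ge0_fin_numE //; exact: lt_trans (lt_b i) (ltry b).
have lt_r : \sum_i r i < #|I|%:R * b.
  have -> : #|I|%:R * b = \sum_(i : I) b by rewrite sumr_const mulr_natl.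
  have [i0 _] := card_gt0P I0.
  apply: ltr_sum => [|i _]; last by rewrite -lte_fin -rE.
  by apply/hasP; exists i0 => //; exact: mem_index_enum.
suff : ((#|I|%:R * b)%:E <= (\sum_i r i)%:E)%E by rewrite lee_fin leNgt lt_r.
rewrite -sumEFin; under eq_bigr do rewrite -rE unlock.
rewrite -ge0_integral_sum //=; last 2 first.
- by move=> i; exact/measurable_EFinP.
- by move=> i w _; rewrite lee_fin.
rewrite -(expectation_cst P) unlock; apply: ge0_le_integral => //=.
- by move=> w _; rewrite lee_fin mulr_ge0.
- by apply: emeasurable_sum => i; exact/measurable_EFinP.
- by move=> w _; rewrite sumEFin lee_fin.
Qed.

Lemma measurable_colors_used (R : realType) (l : nat) (disp : measure_display)
    (T : measurableType disp) (A : randomized_algorithm l T) (n : nat)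
    (G : sgraph 'I_n) :
  measurable_fun [set: T] (fun w => (colors_used A G w)%:R : R).
Proof.
apply: (measurableT_comp (f := fun k : nat => k%:R : R)) => //.
apply: (measurable_size_undup (f := fun t w => online_coloring l (A w) G t)).
by move=> t; exact: measurable_rule.
Qed.

(** * Choice of the parameters *)

(** Bounding [m] by [2 ^ m] leaves a pure power of 8 to compare with [n / d]. *)
Lemma block_size_le (m h d : nat) :
  (2 * h <= d)%N -> (2 * (m * (h * 4 ^ m)) <= 8 ^ m * d)%N.
Proof.
move=> hd; have -> : (8 ^ m = 2 ^ m * 4 ^ m)%N by rewrite -expnMn.
rewrite mulnCA (mulnA 2) mulnA [leqRHS]mulnAC leq_mul2r leq_mul ?orbT //.
by rewrite ltnW // ltn_expl.
Qed.

Lemma level_count (R : realType) (d n l : nat) (c : R) :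
  (2 <= d)%N -> 1 <= c ->
  Num.max (12 * d%:R ^+ 2) (d%:R * 12 `^ (2 * c)) <= n%:R ->
  l%:R <= c * n%:R / log2 (n%:R / d%:R) ->
  exists m : nat, [/\ (0 < m)%N, (m * (d./2 * 4 ^ m + l) + d <= n)%N &
    log2 n%:R <= 12 * c * m%:R].
Proof.
move=> d2 c1; have hd : (2 * d./2 <= d)%N by lia.
rewrite ge_max => /andP[nd2 ndc] ln_le.
have d0 : 0 < d%:R :> R by rewrite ltr0n; lia.
have d2R : 2 <= d%:R :> R by rewrite ler_nat.
have n0 : 0 < n%:R :> R by apply: lt_le_trans nd2; nra.
have L0 : 0 < ln 2 :> R by rewrite ln_gt0 // ltr1n.
pose X : R := log2 (n%:R / d%:R).
have XL : X * ln 2 = ln (n%:R / d%:R) by rewrite /X /log2 divfK // gt_eqF.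
have nd0 : 0 < n%:R / d%:R :> R by rewrite divr_gt0.
have ln8 : ln 8 = 3 * ln 2 :> R.
  have -> : 8 = 2 ^+ 3 :> R by lra.
  by rewrite lnXn // mulr_natl.
(* From [log2 12 >= 3]; the quotient truncated to [m] below is thus at least 2. *)
have X6 : 6 * c <= X.
  rewrite -(ler_pM2r L0) XL; apply: (@le_trans _ _ (ln (12 `^ (2 * c)))).
    rewrite ln_powR.
    have : ln 8 <= ln 12 :> R by rewrite ler_ln ?posrE ?ltr0n ?ler_nat.
    by rewrite ln8; nra.
  by rewrite ler_ln ?posrE ?powR_gt0 ?ltr0n // ler_pdivlMr // mulrC.
have X0 : 0 < X by lra.
have c3 : 0 < 3 * c by lra.
(* [3 m <= X] will give [8 ^ m <= n / d], for the cliques, and [3 c m <= X] will give [3 m l <= n],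
   for the separators. *)
pose m := Num.truncn (X / (3 * c)).
have /andP[m_le m_gt] : m%:R <= X / (3 * c) < m.+1%:R.
  by apply: truncn_itv; rewrite divr_ge0 // ltW.
move: m_le m_gt; rewrite ler_pdivlMr // ltr_pdivrMr // -natr1 => m_le m_gt.
move: m m_le m_gt => m m_le m_gt.
have m1 : 1 < m%:R :> R by nra.
have m0 : (0 < m)%N by rewrite -(ltr_nat R); lra.
have m8 : (8 ^ m * d <= n)%N.
  rewrite -(ler_nat R) natrM natrX -ler_pdivlMr // -ler_ln ?posrE ?exprn_gt0 //.
  rewrite lnXn // -[_ *+ m]mulr_natl ln8 -XL.
  have : 3 * m%:R <= X by nra.
  by move=> ?; nra.
have ml : (3 * (m * l) <= n)%N.
  rewrite -(ler_nat R) !natrM.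
  have : X * l%:R <= c * n%:R by rewrite mulrC -ler_pdivlMr.
  have l0 : 0 <= l%:R :> R by [].
  move=> Xl; have : 3 * c * m%:R * l%:R <= c * n%:R.
    by apply: le_trans Xl; rewrite ler_wpM2r //; lra.
  rewrite (_ : 3 * c * m%:R * l%:R = c * (3 * (m%:R * l%:R))); last by ring.
  by rewrite ler_pM2l //; lra.
have m4 : (2 * (m * (d./2 * 4 ^ m)) <= n)%N.
  by apply: leq_trans m8; exact: block_size_le.
have d24 : (24 * d <= n)%N.
  by move: d2 nd2; rewrite -natrX -natrM ler_nat; clear; nia.
(* Cliques of the tree take at most n/2 positions, separators n/3, the final clique n/24. *)
exists m; split=> //; first rewrite mulnDr.
  by move: m4 ml d24; clear; move: (m * (_ * _))%N (m * l)%N => p q; lia.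
(* As [d ^ 2 <= n], [log2 n] is at most [2 X]; and [X <= 6 c m] because [m + 1 <= 2 m]. *)
have -> : log2 n%:R = (ln (n%:R / d%:R) + ln d%:R) / ln 2 :> R.
  by rewrite -lnM ?posrE // divfK // gt_eqF.
rewrite ler_pdivrMr //.
have : ln d%:R <= ln (n%:R / d%:R) :> R.
  by rewrite ler_ln ?posrE // ler_pdivlMr //; nra.
rewrite -XL => lnd; have : X <= 6 * c * m%:R by nra.
nra.
Qed.

Theorem theorem4 (R : realType) :
  exists2 K : R, 0 < K &
  forall (d : nat) (c : R), (2 <= d)%N -> 1 <= c ->
  forall (l : nat) (disp : measure_display) (T : measurableType disp)
    (P : probability T R) (A : randomized_algorithm l T) (n : nat),
  Num.max (12 * d%:R ^+ 2) (d%:R * 12 `^ (2 * c)) <= n%:R ->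
  l%:R <= c * n%:R / log2 (n%:R / d%:R) ->
  exists G : sgraph 'I_n,
    [/\ chordal G, chromatic_number G = d &
        ((K * (c^-1 * d%:R * log2 n%:R))%:E
           <= 'E_P[fun w => (colors_used A G w)%:R])%E].
Proof.
(* 288 = 8 * 12 * 3: the bound 8 on [gain], then [log2 n <= 12 c m], then [d <= 3 d./2], which is
   tight at [d = 3]. *)
exists 288^-1 => [|d c d2 c1 l disp T P A n n_ge l_le]; first by rewrite invr_gt0.
have [m [m0 room log_le]] := level_count d2 c1 n_ge l_le.
have [g Eg] : exists g : coins m,
    ((d./2%:R * m%:R / 8)%:E <=
     'E_P[fun w => (colors_used A (gadget room g) w)%:R])%E.
  apply: exists_expectation_ge => //.
  - by apply/card_gt0P; exists [ffun=> [ffun=> true]].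
  - by move=> g; exact: measurable_colors_used.
  - by move=> w; apply: sum_coins_colors => // G; exact: proper_rule.
exists (gadget room g); split.
- exact: gadget_chordal.
- by apply: gadget_chromatic; lia.
apply: le_trans Eg; rewrite lee_fin.
have hd : d%:R <= 3 * d./2%:R :> R by rewrite -natrM ler_nat; lia.
have c0 : 0 < c by lra.
rewrite mulrC ler_pdivrMr // -mulrA mulrC ler_pdivrMr //.
have d0 : 0 <= d%:R :> R by [].
have h0 : 0 <= m%:R :> R by [].
have := ler_wpM2l d0 log_le.
have : 12 * (c * m%:R) * d%:R <= 12 * (c * m%:R) * (3 * d./2%:R).
  by rewrite ler_wpM2l // mulr_ge0 // mulr_ge0 // ltW.
lra.
Qed.
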